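(* Let $\Sigma_1$ and $\Sigma_2$ be two seeds which are glueable along subsets $\Delta_1$ and $\Delta_2$ of their clusters, and let $\Sigma=\Sigma_1\coprod_{\Delta_1,\Delta_2}\Sigma_2$ be their amalgamated sum. Then for any $i\in\{1,2\}$, the morphism $\mathcal{F}_{\Sigma_i}\to\mathcal{F}_\Sigma$ induced by the inclusion of the cluster of $\Sigma_i$ into the cluster of $\Sigma$ induces an injective rooted cluster morphism $\mathcal{A}(\Sigma_i)\to\mathcal{A}(\Sigma)$.
   Context: Countable means of cardinality at most $\aleph_0$; rings are unital and ring homomorphisms preserve identities. A seed is a triple $\Sigma=(\mathbf{x},\mathbf{ex},B)$ where $\mathbf{x}$ is a countable set of indeterminates over $\mathbb{Z}$ (the cluster), $\mathbf{ex}\subset\mathbf{x}$ is the set of exchangeable variables (those in $\mathbf{x}\setminus\mathbf{ex}$ are frozen), and $B=(b_{xy})_{x,y\in\mathbf{x}}$ is an integer matrix which is locally finite (each row and column has finite support) and skew-symmetrisable (there are positive integers $d_x$ with $d_xb_{xy}=-d_yb_{yx}$). Put $\mathcal{F}_\Sigma=\mathbb{Q}(x\mid x\in\mathbf{x})$. For $x\in\mathbf{ex}$ the mutation $\mu_x(\Sigma)=(\mathbf{x}',\mathbf{ex}',B')$ is obtained by replacing $x$ in $\mathbf{x}$ and in $\mathbf{ex}$ by $x'\in\mathcal{F}_\Sigma$ with $xx'=\prod_{b_{xy}>0}y^{b_{xy}}+\prod_{b_{xy}<0}y^{-b_{xy}}$, and (identifying the index $x'$ with $x$) $b'_{yz}=-b_{yz}$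 if $x\in\{y,z\}$ and $b'_{yz}=b_{yz}+\frac12(|b_{yx}|b_{xz}+b_{yx}|b_{xz}|)$ otherwise. For $y\in\mathbf{x}$, $\mu_{x,\Sigma}(y)$ is the variable of $\mu_x(\Sigma)$ corresponding to $y$: it is $y$ if $y\ne x$ and $x'$ if $y=x$. A sequence $(x_1,\dots,x_l)$ is $\Sigma$-admissible if $x_1$ is exchangeable in $\Sigma$ and each $x_i$ ($i\ge2$) is exchangeable in $\mu_{x_{i-1}}\circ\cdots\circ\mu_{x_1}(\Sigma)$; $\mu_{x_l}\circ\cdots\circ\mu_{x_1,\Sigma}(y)$ denotes the variable corresponding to $y\in\mathbf{x}$ after these mutations. $\mathrm{Mut}(\Sigma)$ is the set of seeds obtained from $\Sigma$ by mutating along finite (possibly empty) admissible sequences. The rooted cluster algebra $\mathcal{A}(\Sigma)$ is the $\mathbb{Z}$-subalgebra of $\mathcal{F}_\Sigma$ generated by all variables in clusters of seeds in $\mathrm{Mut}(\Sigma)$, considered together with its initial seed $\Sigma$. For seeds $\Sigma=(\mathbf{x},\mathbf{ex},B)$, $\Sigma'=(\mathbf{x}',\mathbf{ex}',B')$ and a map $f:\mathcal{A}(\Sigma)\to\mathcal{A}(\Sigma')$, a sequence $(x_1,\dots,x_n)$ is $(f,\Sigma,\Sigma')$-biadmissible if it is $\Sigma$-admissible and $(f(x_1),\dots,f(x_n))$ is $\Sigma'$-admissible. A rooted cluster morphism $\mathcal{A}(\Sigma)\to\mathcal{A}(\Sigma')$ is a ring homomorphism $f$ such that (CM1) $f(\mathbf{x})\subset\mathbf{x}'\sqcup\mathbb{Z}$;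 (CM2) $f(\mathbf{ex})\subset\mathbf{ex}'\sqcup\mathbb{Z}$; (CM3) for every $(f,\Sigma,\Sigma')$-biadmissible sequence $(x_1,\dots,x_n)$ and every $y\in\mathbf{x}$, $f(\mu_{x_n}\circ\cdots\circ\mu_{x_1,\Sigma}(y))=\mu_{f(x_n)}\circ\cdots\circ\mu_{f(x_1),\Sigma'}(f(y))$, where mutations fix integers. Two seeds are isomorphic if there is a bijection of clusters, restricting to a bijection of the sets of exchangeable variables, which preserves the matrix entries. For $J\subset\mathbf{x}$ the full subseed $\Sigma_{|J}$ is $(J,\mathbf{ex}\cap J,B[J])$ with $B[J]=(b_{xy})_{x,y\in J}$. Seeds $\Sigma_i=(\mathbf{x}_i,\mathbf{ex}_i,B^i)$, $i=1,2$, are glueable along $\Delta_1,\Delta_2$ if $\Delta_i\subset\mathbf{x}_i\setminus\mathbf{ex}_i$ are (possibly empty) sets of frozen variables for which there is an isomorphism of seeds $\Sigma_{1|\Delta_1}\simeq\Sigma_{2|\Delta_2}$ (which is fixed). Let $\Delta$ be a set of indeterminates identified with $\Delta_1$ and $\Delta_2$ via this isomorphism. Writing, with respect to $\mathbf{x}_i=(\mathbf{x}_i\setminus\Delta_i)\sqcup\Delta$, $B^i=\begin{pmatrix} B^i_{11} & B^i_{12} \\ B^i_{21} & B_\Delta \end{pmatrix}$, the amalgamated sum $\Sigma_1\coprod_{\Delta_1,\Delta_2}\Sigma_2$ is the seed with cluster $(\mathbf{x}_1\setminus\Delta_1)\sqcup(\mathbf{x}_2\setminus\Delta_2)\sqcup\Delta$,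 exchangeable variables $\mathbf{ex}_1\sqcup\mathbf{ex}_2$, and exchange matrix $\begin{pmatrix} B^1_{11} & 0 & B^1_{12} \\ 0 & B^2_{11} & B^2_{12} \\ B^1_{21} & B^2_{21} & B_\Delta \end{pmatrix}$. *)

(* Defs.v *)
From HB Require Import structures.
From mathcomp Require Import all_boot all_order all_algebra.
From mathcomp Require Import finmap.
From mathcomp Require Import monalg.
From mathcomp Require Import boolp classical_sets functions cardinality fsbigop.

Set Implicit Arguments.
Unset Strict Implicit.
Unset Printing Implicit Defensive.

Import GRing.Theory.
Local Open Scope ring_scope.

(* Q[x_i | i : I] *)
Notation polyring I := {malg rat[{cmonom I}]}.

Section IntegralDomain.
Variable I : countType.
Implicit Types (m : {cmonom I}) (p q : polyring I) (N n : nat).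

Lemma kron_digits_inj N n (a b : nat -> nat) :
  (forall j, a j < N)%N -> (forall j, b j < N)%N ->
  (\sum_(j < n) a j * N ^ j = \sum_(j < n) b j * N ^ j)%N ->
  forall j, (j < n)%N -> a j = b j.
Proof.
elim: n a b => [//|n IHn] a b ltaN ltbN.
have N_gt0 : (0 < N)%N by apply: leq_ltn_trans (ltaN 0).
have shift (c : nat -> nat) : (\sum_(j < n.+1) c j * N ^ j =
    c 0 + N * \sum_(j < n) c j.+1 * N ^ j)%N.
  rewrite big_ord_recl expn0 muln1; congr addn.
  by rewrite big_distrr; apply: eq_bigr => j _; rewrite /= expnS mulnCA.
rewrite !shift => eq_ab.
have eq0 : a 0 = b 0.
  have := congr1 (modn^~ N) eq_ab.
  by rewrite /= !(addnC _ (N * _)%N) !(mulnC N) !modnMDl !modn_small.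
have := eq_ab; rewrite eq0 => /addnI /eqP; rewrite eqn_pmul2l // => /eqP eqS.
by case=> [//|j]; rewrite ltnS; apply: (IHn (a \o succn) (b \o succn)) => //= k.
Qed.

(* Integrality is transported from rat['X] by the Kronecker substitution
   x_i |-> 'X^(N ^ pickle i), which is injective on monomials with exponents
   < N in variables of rank < n.                                              *)
Definition kron_digit m j : nat := oapp m 0%N (@choice.pickle_inv I j).
Definition kron_weight N n m : nat := (\sum_(j < n) kron_digit m j * N ^ j)%N.

Lemma kron_digitM m1 m2 j : kron_digit (mmul m1 m2) j = (kron_digit m1 j + kron_digit m2 j)%N.
Proof. by rewrite /kron_digit; case: pickle_inv => //= i; rewrite cmM. Qed.

Definition kron N n m : {poly rat} := 'X^(kron_weight N n m).

Lemma kron_morph N n : mmorphism (kron N n).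
Proof.
split=> [m1 m2|]; rewrite /kron /kron_weight.
  rewrite -exprD; congr ('X^_); rewrite -big_split; apply: eq_bigr => j _.
  by rewrite kron_digitM mulnDl.
rewrite big1 // => j _; rewrite /kron_digit.
by case: pickle_inv => //= i; rewrite cm1.
Qed.

HB.instance Definition _ N n :=
  monalg.isMultiplicative.Build {cmonom I} {poly rat} (kron N n) (kron_morph N n).

Lemma kron_weight_inj N n m1 m2 :
  (forall i, m1 i < N)%N -> (forall i, m2 i < N)%N ->
  (forall i, m1 i != 0 -> choice.pickle i < n)%N ->
  (forall i, m2 i != 0 -> choice.pickle i < n)%N ->
  kron_weight N n m1 = kron_weight N n m2 -> m1 = m2.
Proof.
move=> lt1 lt2 n1 n2 /kron_digits_inj eqd.
have N_gt0 i : (0 < N)%N := leq_ltn_trans (leq0n _) (lt1 i).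
have dN m : (forall i, m i < N)%N -> (0 < N)%N -> forall j, (kron_digit m j < N)%N.
  by move=> ltm N0 j; rewrite /kron_digit; case: pickle_inv => /=.
apply/eqP/cmP => i; case: (ltnP (choice.pickle i) n) => [lt_i|le_i].
  have := eqd (dN _ lt1 (N_gt0 i)) (dN _ lt2 (N_gt0 i)) _ lt_i.
  by rewrite /kron_digit choice.pickleK_inv.
have z m : (forall i, m i != 0 -> choice.pickle i < n)%N -> m i = 0%N.
  move=> nm; apply/eqP; apply/negPn/negP => /nm.
  by rewrite ltnNge le_i.
by rewrite !z.
Qed.

Lemma kron_neq0 p : p != 0 -> forall N n,
  (forall m, m \in msupp p -> forall i, m i < N)%N ->
  (forall m, m \in msupp p -> forall i, m i != 0 -> choice.pickle i < n)%N ->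
  mmap polyC (kron N n) p != 0.
Proof.
move=> p_neq0 N n hN hn.
have [m0 m0p] : exists m, m \in msupp p.
  by apply/fset0Pn; rewrite msupp_eq0.
apply/eqP => /(congr1 (fun r : {poly rat} => r`_(kron_weight N n m0))).
rewrite coef0 mmapE coef_sum (bigD1_seq m0) //= ?fset_uniq //.
rewrite coefCM /kron coefXn eqxx mulr1 big_seq_cond big1 ?addr0.
  by move/eqP; rewrite mcoeff_eq0 m0p.
move=> m /andP[mp neq]; rewrite coefCM coefXn.
case: eqVneq => [eqw|]; last by rewrite mulr0.
case/eqP: neq.
exact: kron_weight_inj (hN _ mp) (hN _ m0p) (hn _ mp) (hn _ m0p) (esym eqw).
Qed.

Lemma bound_monomials (s : seq {cmonom I}) : exists n,
  (forall m, m \in s -> forall i, m i < n)%N /\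
  (forall m, m \in s -> forall i, m i != 0 -> choice.pickle i < n)%N.
Proof.
elim: s => [|m s [n [h1 h2]]]; first by exists 0%N.
pose n1 := (\max_(i <- finsupp m) maxn (m i) (choice.pickle i)).+1.
have n1P i : m i != 0%N -> (maxn (m i) (choice.pickle i) < n1)%N.
  rewrite cmE_neq0 /n1 ltnS => mi.
  rewrite (big_fsetD1 i) //=.
  exact: leq_maxl.
exists (maxn n n1); split=> m'; rewrite inE => /orP[/eqP->|m's] i.
- have [->|mi] := eqVneq (m i) 0%N; first by rewrite leq_max orbT.
  by rewrite leq_max (leq_ltn_trans _ (n1P i mi)) ?orbT ?leq_maxl.
- by rewrite leq_max h1.
- by move=> mi; rewrite leq_max (leq_ltn_trans _ (n1P i mi)) ?orbT ?leq_maxr.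
- by move=> mi; rewrite leq_max (h2 m').
Qed.

Lemma polyring_integral p q : p * q = 0 -> (p == 0) || (q == 0).
Proof.
move=> pq0; case: eqVneq => //= p0; case: eqVneq => //= q0.
have [n [hN hn]] := bound_monomials (msupp p ++ msupp q).
have kp : mmap polyC (kron n n) p != 0.
  by apply: kron_neq0 => // m mp; [apply: hN|apply: hn]; rewrite mem_cat mp.
have kq : mmap polyC (kron n n) q != 0.
  by apply: kron_neq0 => // m mp; [apply: hN|apply: hn]; rewrite mem_cat mp orbT.
have := mulf_neq0 kp kq.
by rewrite -(monalg.mmap_is_multiplicative (f := polyC) (h := kron n n)).1 pq0 mmap0 eqxx.
Qed.

Definition polyring_unit : {pred polyring I} :=
  fun p => `[< exists q, q * p = 1 >].
Definition polyring_inv p : polyring I :=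
  if pselect (exists q, q * p = 1) is left ex then projT1 (cid ex) else p.

Lemma polyring_mulVx : {in polyring_unit, left_inverse 1 polyring_inv *%R}.
Proof.
move=> p /asboolP ex; rewrite /polyring_inv; case: pselect => // ex'.
exact: projT2 (cid ex').
Qed.

Lemma polyring_unitPl p q : q * p = 1 -> polyring_unit p.
Proof. by move=> qp1; apply/asboolP; exists q. Qed.

Lemma polyring_invr_out : {in [predC polyring_unit], polyring_inv =1 id}.
Proof.
move=> p; rewrite inE => /asboolPn nex.
by rewrite /polyring_inv; case: pselect.
Qed.

HB.instance Definition _ := GRing.ComNzRing_hasMulInverse.Build (polyring I)
  polyring_mulVx polyring_unitPl polyring_invr_out.
HB.instance Definition _ := GRing.ComUnitRing_isIntegral.Build (polyring I)
  polyring_integral.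

End IntegralDomain.

(* Q(x_i | i : I), as the field of fractions of Q[x_i | i : I] *)
Definition ratfun (I : countType) : fieldType := {fraction polyring I}.

Definition indet (I : countType) (i : I) : ratfun I :=
  FracField.tofrac (<< ucm i >> : polyring I).

(* The data (ex, B) on a cluster of indeterminates labelled by I; it is a
   seed when moreover [is_seed] holds.                                        *)
Record exchange_data (I : countType) := ExchangeData {
  ex : {pred I};
  bmat : I -> I -> int
}.

Definition locally_finite (I : countType) (B : I -> I -> int) : Prop :=
  (forall x, exists s : seq I, forall y, B x y != 0 -> y \in s) /\
  (forall y, exists s : seq I, forall x, B x y != 0 -> x \in s).

Definition skew_symmetrisable (I : countType) (B : I -> I -> int) : Prop :=
  exists d : I -> int, (forall x, 0 < d x) /\
    (forall x y, d x * B x y = - (d y * B y x)).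

Definition is_seed (I : countType) (S : exchange_data I) : Prop :=
  locally_finite (bmat S) /\ skew_symmetrisable (bmat S).

(* A seed whose cluster consists of elements of Q(x_i | i : I). The variable
   corresponding to the initial variable x_i keeps the label i along
   mutations, so ex never changes.                                            *)
Record labelled_seed (I : countType) := LabelledSeed {
  var : I -> ratfun I;
  data : exchange_data I
}.

Definition initial_seed (I : countType) (S : exchange_data I) :
    labelled_seed I := LabelledSeed (@indet I) S.

Section Mutation.
Variable I : countType.
Implicit Types (k i y z : I) (S : exchange_data I) (L : labelled_seed I).

(* The two monomials are finitely supported products, since row k of a locally
   finite matrix is finite.                                                   *)
Definition exchange_numerator L k : ratfun I :=
  let b := bmat (data L) in
  \big[*%R/1]_(y \in [set y | 0 < b k y]%classic) var L y ^+ `|b k y|%N +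
  \big[*%R/1]_(y \in [set y | b k y < 0]%classic) var L y ^+ `|b k y|%N.

Definition mutate_matrix (b : I -> I -> int) k : I -> I -> int :=
  fun y z => if (k == y) || (k == z) then - b y z
    else b y z + ((`|b y k| * b k z + b y k * `|b k z|) %/ 2)%Z.

Definition mutate k L : labelled_seed I :=
  LabelledSeed
    (fun i => if i == k then exchange_numerator L k / var L k else var L i)
    (ExchangeData (ex (data L)) (mutate_matrix (bmat (data L)) k)).

(* [mutates L s L'] : s is an L-admissible sequence, and mutating L
   successively at the elements of s yields L'.                               *)
Fixpoint mutates L (s : seq (ratfun I)) L' : Prop :=
  if s is x :: s' then
    exists k, [/\ k \in ex (data L), var L k = x & mutates (mutate k L) s' L']
  else L' = L.

Definition in_Mut S L : Prop := exists s, mutates (initial_seed S) s L.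

(* Least subring containing the variables of all the clusters of Mut(S). *)
Definition cluster_subring S : {pred ratfun I} := fun x =>
  `[< forall Q : {pred ratfun I}, subring_closed Q ->
      (forall L i, in_Mut S L -> var L i \in Q) -> x \in Q >].

Lemma cluster_subringP S : subring_closed (cluster_subring S).
Proof.
split=> [|x y /asboolP hx /asboolP hy|x y /asboolP hx /asboolP hy];
  apply/asboolP => Q Qring Qvar.
- by case: Qring.
- by case: (Qring) => _ QB _; apply: QB; [apply: hx|apply: hy].
- by case: (Qring) => _ _ QM; apply: QM; [apply: hx|apply: hy].
Qed.

HB.instance Definition _ S := GRing.isSubringClosed.Build (ratfun I)
  (cluster_subring S) (cluster_subringP S).

Lemma in_Mut_initial S : in_Mut S (initial_seed S).
Proof. by exists [::]. Qed.

Lemma mutates_in_Mut S s L : mutates (initial_seed S) s L -> in_Mut S L.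
Proof. by exists s. Qed.

Lemma var_in_cluster_subring S L i :
  in_Mut S L -> var L i \in cluster_subring S.
Proof. by move=> LS; apply/asboolP => Q _; apply. Qed.

Record cluster_algebra S := ClusterAlgebra {
  cval :> ratfun I;
  cvalP : cval \in cluster_subring S
}.

HB.instance Definition _ S := [isSub for @cval S].
HB.instance Definition _ S := [Choice of cluster_algebra S by <:].
HB.instance Definition _ S :=
  [SubChoice_isSubComNzRing of cluster_algebra S by <:].

Definition cluster_var S L (LS : in_Mut S L) i : cluster_algebra S :=
  ClusterAlgebra (var_in_cluster_subring i LS).

Definition initial_var S i : cluster_algebra S :=
  cluster_var (in_Mut_initial S) i.

End Mutation.

Section RootedClusterMorphism.
Variables (I I' : countType) (S : exchange_data I) (S' : exchange_data I').
Implicit Type f : {rmorphism cluster_algebra S -> cluster_algebra S'}.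

Definition is_integer (u : cluster_algebra S') : Prop :=
  exists n : int, u = n%:~R.

Definition CM1 f : Prop := forall x : I,
  (exists x', f (initial_var S x) = initial_var S' x') \/
  is_integer (f (initial_var S x)).

Definition CM2 f : Prop := forall x : I, x \in ex S ->
  (exists2 x', x' \in ex S' & f (initial_var S x) = initial_var S' x') \/
  is_integer (f (initial_var S x)).

(* [mutated_along L' u v] : v is the element obtained from u, an integer or
   an initial variable, by the mutations which lead from S' to L'.            *)
Definition mutated_along (L' : labelled_seed I') (u v : cluster_algebra S') :
    Prop :=
  (is_integer u /\ v = u) \/
  (exists2 x', u = initial_var S' x' & cval v = var L' x').

Definition CM3 f : Prop :=
  forall (s : seq (cluster_algebra S)) (L : labelled_seed I)
         (L' : labelled_seed I')
         (adm : mutates (initial_seed S) (map (@cval I S) s) L),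
    mutates (initial_seed S') (map (fun x => cval (f x)) s) L' ->
    forall y : I, mutated_along L' (f (initial_var S y))
                    (f (cluster_var (mutates_in_Mut adm) y)).

Definition rooted_cluster_morphism f : Prop := [/\ CM1 f, CM2 f & CM3 f].

(* The field morphism phi extending an injection h of clusters is unique,
   since ratfun I is generated by the indeterminates as a field.              *)
Definition induces_injective_rooted_cluster_morphism (h : I -> I') : Prop :=
  exists phi : {rmorphism ratfun I -> ratfun I'},
    (forall x, phi (indet x) = indet (h x)) /\
    exists f : {rmorphism cluster_algebra S -> cluster_algebra S'},
      [/\ forall a, cval (f a) = phi (cval a),
          injective f
        & rooted_cluster_morphism f].

End RootedClusterMorphism.

Definition full_subseed (I : countType) (S : exchange_data I) (J : {pred I}) :
    exchange_data {x | x \in J} :=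
  ExchangeData [pred x | val x \in ex S]
    (fun x y => bmat S (val x) (val y)).

Record seed_iso (I I' : countType)
    (S : exchange_data I) (S' : exchange_data I') := SeedIso {
  iso_fun : I -> I';
  iso_inv : I' -> I;
  iso_funK : cancel iso_fun iso_inv;
  iso_invK : cancel iso_inv iso_fun;
  iso_ex : forall x, (iso_fun x \in ex S') = (x \in ex S);
  iso_bmat : forall x y, bmat S' (iso_fun x) (iso_fun y) = bmat S x y
}.

Record glueing (I1 I2 : countType)
    (S1 : exchange_data I1) (S2 : exchange_data I2)
    (D1 : {pred I1}) (D2 : {pred I2}) := Glueing {
  frozen1 : forall x, x \in D1 -> x \notin ex S1;
  frozen2 : forall x, x \in D2 -> x \notin ex S2;
  glue_iso : seed_iso (full_subseed S1 D1) (full_subseed S2 D2)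
}.

Section AmalgamatedSum.
Variables (I1 I2 : countType) (S1 : exchange_data I1) (S2 : exchange_data I2).
Variables (D1 : {pred I1}) (D2 : {pred I2}) (g : glueing S1 S2 D1 D2).

(* The common set Delta of glued variables is taken to be D1. *)
Definition amalg_index : countType :=
  ({x | x \notin D1} + {x | x \notin D2} + {x | x \in D1})%type.

Definition glue (x : {x | x \in D1}) : I2 := val (iso_fun (glue_iso g) x).

Definition amalg_ex : {pred amalg_index} := fun x =>
  match x with
  | inl (inl x1) => val x1 \in ex S1
  | inl (inr x2) => val x2 \in ex S2
  | inr _ => false
  end.

Definition amalg_bmat (x y : amalg_index) : int :=
  match x, y with
  | inl (inl x1), inl (inl y1) => bmat S1 (val x1) (val y1)
  | inl (inl _),  inl (inr _)  => 0
  | inl (inl x1), inr y0       => bmat S1 (val x1) (val y0)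
  | inl (inr _),  inl (inl _)  => 0
  | inl (inr x2), inl (inr y2) => bmat S2 (val x2) (val y2)
  | inl (inr x2), inr y0       => bmat S2 (val x2) (glue y0)
  | inr x0,       inl (inl y1) => bmat S1 (val x0) (val y1)
  | inr x0,       inl (inr y2) => bmat S2 (glue x0) (val y2)
  | inr x0,       inr y0       => bmat S1 (val x0) (val y0)
  end.

(* Local finiteness passes to the sum, but skew-symmetrisability of S1 and S2
   need not: the symmetrisers may disagree on glued variables. Nothing here
   requires the sum to satisfy [is_seed].                                     *)
Definition amalgamated_sum : exchange_data amalg_index :=
  ExchangeData amalg_ex amalg_bmat.

Definition amalg_incl1 (x : I1) : amalg_index :=
  match boolP (x \in D1) with
  | AltTrue h => inr (exist _ x h)
  | AltFalse h => inl (inl (exist _ x h))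
  end.

Definition amalg_incl2 (x : I2) : amalg_index :=
  match boolP (x \in D2) with
  | AltTrue h => inr (iso_inv (glue_iso g) (exist _ x h))
  | AltFalse h => inl (inr (exist _ x h))
  end.

End AmalgamatedSum.

(* Main.v *)
(* Mutating a skew-symmetrisable seed at k replaces x_k by P / x_k, where the
   exchange polynomial P is nonzero and does not involve x_k; this substitution
   is injective on polynomials, so it extends to an endomorphism of the field of
   rational functions.  Composing such endomorphisms, every cluster reached
   from the initial one is the image of the indeterminates under a field
   endomorphism; in particular its variables are pairwise distinct.

   In the amalgamated sum, the row of a variable exchangeable in S_i vanishes
   outside of the cluster of S_i, and mutating at such variables preserves this.
   So mutations of S_i are mirrored in the sum.  Conversely a biadmissible
   sequence determines the mutated labels on both sides, because the variables
   of the sum outside of the cluster of S_i are never mutated and are not in the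
   image of the field of S_i. *)

Require Import Defs.
From HB Require Import structures.
From mathcomp Require Import all_boot all_order all_algebra.
From mathcomp Require Import finmap monalg.
From mathcomp Require Import boolp classical_sets cardinality fsbigop.
From mathcomp Require Import ring zify.

Set Implicit Arguments.
Unset Strict Implicit.
Unset Printing Implicit Defensive.

Import Order.TTheory GRing.Theory Num.Theory.
Local Open Scope ring_scope.

Local Notation "''x_' i" := (<< ucm i >> : polyring _)
  (at level 8, i at level 2, format "''x_' i").
Local Notation frac := (@FracField.tofrac _).

(** * Evaluation morphisms on polynomial rings and their uniqueness *)

Section PolynomialEvaluation.
Variables (I : countType) (R : comNzRingType).
Implicit Type m : {cmonom I}.

Definition monom_eval (v : I -> R) m : R := \prod_(i <- finsupp m) v i ^+ m i.

Lemma monom_evalEw (v : I -> R) m (d : {fset I}) : (finsupp m `<=` d)%fset ->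
  monom_eval v m = \prod_(i <- d) v i ^+ m i.
Proof.
move=> le_md; rewrite /monom_eval (big_fset_incl _ le_md) // => i _.
by rewrite -cmE_neq0 negbK => /eqP ->.
Qed.

Lemma monom_eval_mmorphism v : mmorphism (monom_eval v).
Proof.
split=> [m1 m2|]; last by rewrite /monom_eval mdom1 big_seq_fset0.
rewrite {1}/monom_eval mdomD.
rewrite (monom_evalEw v (fsubsetUl _ (finsupp m2))).
rewrite (monom_evalEw v (fsubsetUr (finsupp m1) _)).
by rewrite -big_split; apply: eq_bigr => i _; rewrite cmM exprD.
Qed.

HB.instance Definition _ v := monalg.isMultiplicative.Build {cmonom I} R
  (monom_eval v) (monom_eval_mmorphism v).

Definition poly_eval (f : {rmorphism rat -> R}) (v : I -> R) :
  {rmorphism polyring I -> R} := mmap f (monom_eval v).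

Lemma poly_evalX f v i : poly_eval f v 'x_i = v i.
Proof.
rewrite /poly_eval /= mmapU [X in X * _](rmorph1 f) mul1r /monom_eval.
by rewrite mdomU big_seq_fset1 cmUU expr1.
Qed.

End PolynomialEvaluation.

(** With [d] the denominator of [q], [f q = f q * g d * g d^-1 = f (q * d) * g d^-1], and [f], [g]
    agree on the integers [d] and [q * d]. No inverse is taken in [R]. *)
Lemma rat_rmorph_unique (R : nzRingType) (f g : {rmorphism rat -> R}) : f =1 g.
Proof.
have eq_int n : f n%:~R = g n%:~R by rewrite !rmorph_int.
move=> q; have d_neq0 : (denq q)%:~R != 0 :> rat by rewrite intr_eq0 denq_neq0.
rewrite -[LHS]mulr1 -(rmorph1 g) -(mulfV d_neq0) rmorphM mulrA /=.
rewrite -[in f q * _]eq_int -rmorphM -[q in f (q * _)]divq_num_den divfK //.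
by rewrite eq_int -rmorphM divq_num_den.
Qed.

(** This reduces the substitution identities below to a check on indeterminates. Each monomial is
    rebuilt as a product of indeterminates; coefficients are settled by [rat_rmorph_unique]. *)
Lemma polyring_rmorph_ext (I : countType) (R : nzRingType)
    (f g : {rmorphism polyring I -> R}) :
  (forall i, f 'x_i = g 'x_i) -> f =1 g.
Proof.
move=> eqX p.
have eqC c : f (malgC c) = g (malgC c).
  exact: (rat_rmorph_unique (f \o @malgC _ rat) (g \o @malgC _ rat)).
have monomM (m1 m2 : {cmonom I}) :
    (<< mmul m1 m2 >> : polyring I) = << m1 >> * << m2 >>.
  by rewrite malgM_def fgmulUU mulr1.
have eqm (m : {cmonom I}) : f << m >> = g << m >>.
  have -> : m =
      \big[mmul/mone]_(i <- finsupp m) \big[mmul/mone]_(j < m i) ucm i.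
    apply/eqP/cmP => j.
    rewrite (big_morph (fun m : {cmonom I} => m j) (@cmM _ j) (cm1 j)).
    under eq_bigr => i _.
      rewrite (big_morph (fun m : {cmonom I} => m j) (@cmM _ j) (cm1 j)).
      rewrite sum_nat_const card_ord cmU; over.
    have [jm|] := boolP (j \in finsupp m).
      rewrite (big_fsetD1 j) //= eqxx muln1 big_seq big1 ?addn0 // => i.
      by rewrite !inE => /andP[/negPf -> _]; rewrite muln0.
    move=> jm; rewrite big_seq big1.
      by apply/eqP; rewrite cmE_eq0.
    move=> i im; case: eqVneq => [eij|_]; last by rewrite muln0.
    by rewrite -eij im in jm.
  rewrite (big_morph (fun m => << m >> : polyring I) monomM (erefl _)).
  rewrite !rmorph_prod; apply: eq_bigr => i _.
  rewrite (big_morph (fun m => << m >> : polyring I) monomM (erefl _)).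
  by rewrite !rmorph_prod; apply: eq_bigr.
rewrite (monalgE p) !rmorph_sum; apply: eq_bigr => m _.
have -> : << p@_m *g m >> = malgC p@_m * << m >>.
  by rewrite malgM_def fgmulUU mulr1 mul1m.
transitivity (f (malgC p@_m) * f << m >>); first exact: rmorphM.
transitivity (g (malgC p@_m) * g << m >>); last by apply: esym; exact: rmorphM.
by congr (_ * _).
Qed.

(** * Extension of injective morphisms to fraction fields *)

Section FractionLift.
Variables (R : idomainType) (F : fieldType) (e : {rmorphism R -> F}).
Hypothesis e_inj : injective e.

Lemma fracP (x : {fraction R}) :
  exists r : R * R, r.2 != 0 /\ x = frac r.1 / frac r.2.
Proof.
elim/quotW: x => -[[a b] /= b_neq0]; exists (a, b); split=> //=.
rewrite -[RHS]/(FracField.mul _ (FracField.inv _)) !piE.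
congr (\pi_ _)%qT; apply: val_inj => /=.
rewrite /FracField.mulf /FracField.invf.
by rewrite !(numden_Ratio, oner_neq0, mul1r, mulr1) //; case: RatioP => // b0;
  rewrite b0 eqxx in b_neq0.
Qed.

Definition frac_lift_fun (x : {fraction R}) : F :=
  let r := projT1 (cid (fracP x)) in e r.1 / e r.2.

(** The representative chosen in [frac_lift_fun] is immaterial: injectivity of [e] keeps
    denominators nonzero, so cross-multiplied equalities carry over to [F]. *)
Lemma frac_lift_div a b : b != 0 ->
  frac_lift_fun (frac a / frac b) = e a / e b.
Proof.
move=> b0; rewrite /frac_lift_fun; case: cid => -[n d] /= [d0] /eqP.
rewrite eqr_div ?tofrac_eq0 // -!rmorphM tofrac_eq => /eqP eq_nd.
have eK u : u != 0 -> e u != 0 by rewrite -(rmorph0 e) (inj_eq e_inj).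
by apply/eqP; rewrite eqr_div ?eK // -!rmorphM eq_nd.
Qed.

Lemma frac_lift_is_zmod_morphism : zmod_morphism frac_lift_fun.
Proof.
have eK u : u != 0 -> e u != 0 by rewrite -(rmorph0 e) (inj_eq e_inj).
move=> x y; have [[a b] [/= b0 ->]] := fracP x.
have [[c d] [/= d0 ->]] := fracP y.
rewrite !frac_lift_div // -!mulNr -rmorphN addf_div ?tofrac_eq0 //.
rewrite -!rmorphM -rmorphD frac_lift_div ?mulf_neq0 //.
by rewrite rmorphD !rmorphM rmorphN addf_div ?eK.
Qed.

Lemma frac_lift_is_monoid_morphism : monoid_morphism frac_lift_fun.
Proof.
split.
  have := frac_lift_div 1 (oner_neq0 R).
  by rewrite !rmorph1 !divr1.
move=> x y; have [[a b] [/= b0 ->]] := fracP x.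
have [[c d] [/= d0 ->]] := fracP y.
rewrite !frac_lift_div // [in LHS]mulf_div -2![in LHS]rmorphM.
by rewrite frac_lift_div ?mulf_neq0 // !rmorphM mulf_div.
Qed.

HB.instance Definition _ := GRing.isZmodMorphism.Build _ _ frac_lift_fun
  frac_lift_is_zmod_morphism.
HB.instance Definition _ := GRing.isMonoidMorphism.Build _ _ frac_lift_fun
  frac_lift_is_monoid_morphism.

Lemma frac_lift_tofrac a : frac_lift_fun (frac a) = e a.
Proof.
by have := frac_lift_div a (oner_neq0 R); rewrite !rmorph1 !divr1.
Qed.

Lemma frac_lift : exists E : {rmorphism {fraction R} -> F},
  forall a, E (frac a) = e a.
Proof. by exists frac_lift_fun; exact: frac_lift_tofrac. Qed.

End FractionLift.

(** * The exchange substitution and its injectivity *)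

Section ExchangeSubstitution.
Variables (I : countType) (k : I).
Implicit Types p P : polyring I.

(* [p] as a polynomial in the variable [x_k]; its coefficients are kept in the
   whole ring rather than in the polynomials in the other variables. *)
Definition poly_in_var : {rmorphism polyring I -> {poly polyring I}} :=
  poly_eval (polyC \o @malgC _ rat : {rmorphism rat -> {poly polyring I}})
    (fun i => if i == k then 'X else ('x_i)%:P).

Definition free_of_var p : Prop := poly_in_var p = p%:P.

Lemma poly_in_varX i : poly_in_var 'x_i = if i == k then 'X else ('x_i)%:P.
Proof. exact: poly_evalX. Qed.

Lemma poly_in_var_eval p : (poly_in_var p).['x_k] = p.
Proof.
apply: (polyring_rmorph_ext
  (f := horner_eval ('x_k) \o poly_in_var : {rmorphism _ -> _}) (g := idfun)).
move=> i /=; rewrite poly_in_varX /horner_eval.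
by case: eqVneq => [->|_]; rewrite ?hornerX ?hornerC.
Qed.

(** Expanding the coefficients again and embedding them as constants are both ring morphisms in [p],
    and they agree on indeterminates. *)
Lemma poly_in_var_coef p j : free_of_var (poly_in_var p)`_j.
Proof.
have /(congr1 (fun q : {poly {poly polyring I}} => q`_j)) :
    map_poly poly_in_var (poly_in_var p) = map_poly polyC (poly_in_var p).
  apply: (polyring_rmorph_ext
    (f := map_poly poly_in_var \o poly_in_var : {rmorphism _ -> _})
    (g := map_poly polyC \o poly_in_var : {rmorphism _ -> _})).
  move=> i /=; rewrite poly_in_varX; case: eqVneq => [_|ik].
    by rewrite !map_polyX.
  by rewrite !map_polyC /= poly_in_varX (negPf ik).
by rewrite !coef_map.
Qed.

Definition exchange_subst P : {rmorphism polyring I -> ratfun I} :=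
  poly_eval (frac \o @malgC _ rat : {rmorphism rat -> ratfun I})
    (fun i => if i == k then frac P / indet k else indet i).

Lemma exchange_substE P p :
  exchange_subst P p = (map_poly frac (poly_in_var p)).[frac P / indet k].
Proof.
apply: (polyring_rmorph_ext (g := horner_eval (frac P / indet k) \o
  map_poly frac \o poly_in_var : {rmorphism _ -> _})).
move=> i /=; rewrite poly_evalX poly_in_varX /horner_eval.
by case: eqVneq => _; rewrite ?map_polyX ?hornerX // map_polyC hornerC.
Qed.

Lemma indet_neq0 i : indet i != 0 :> ratfun I.
Proof. by rewrite tofrac_eq0 monalgU_eq0 oner_neq0. Qed.

Lemma exchange_subst_inj P :
  P != 0 -> free_of_var P -> injective (exchange_subst P).
Proof.
move=> P0 freeP.
suff: forall p, exchange_subst P p = 0 -> p = 0 by exact: raddf_inj.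
move=> p; rewrite exchange_substE => ep0.
set q := poly_in_var p in ep0; pose n := size q.
(* Clearing denominators: the image of [r] in the fraction field is [x_k ^ n]
   times the value [ep0], while its expansion in [x_k] is [q] up to reversal
   and the factors [P ^ j]. *)
pose r := \sum_(j < n) q`_j * P ^+ j * 'x_k ^+ (n - j).
have r0 : r = 0.
  apply/eqP; rewrite -tofrac_eq0; apply/eqP.
  transitivity (indet k ^+ n * (map_poly frac q).[frac P / indet k]);
    last by rewrite ep0 mulr0.
  rewrite (horner_coef_wide _ (size_poly _ _)) mulr_sumr rmorph_sum.
  apply: eq_bigr => j _; rewrite coef_map !rmorphM !rmorphXn /=.
  rewrite exprMn exprVn -/(indet k).
  rewrite -[n in RHS](subnK (ltnW (ltn_ord j))) exprD.
  have field_id (F : fieldType) (a b u v : F) : u != 0 ->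
    a * b * v = v * u * (a * (b / u)) by move=> u0; field.
  exact/field_id/expf_neq0/indet_neq0.
(* As [P] and the [q_j] are free of [x_k], this is the expansion of [r] in [x_k]. The exponents
   [n - j] are distinct, so each [q_j * P ^ j] vanishes. *)
have rq : \sum_(j < n) (q`_j * P ^+ j) *: 'X^(n - j) = 0 :> {poly polyring I}.
  transitivity (poly_in_var r); last by rewrite r0 rmorph0.
  rewrite rmorph_sum; apply: eq_bigr => j _.
  rewrite !rmorphM !rmorphXn poly_in_varX eqxx.
  rewrite [poly_in_var q`_j]poly_in_var_coef [poly_in_var P]freeP.
  by rewrite -mul_polyC rmorphM rmorphXn.
suff q0 : q = 0 by rewrite -(poly_in_var_eval p) -/q q0 horner0.
apply/polyP => j; rewrite coef0.
have [jn|?] := ltnP j n; last by rewrite nth_default.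
have /(congr1 (fun f : {poly polyring I} => f`_(n - j))) := rq.
rewrite coef_sum coef0 (bigD1 (Ordinal jn)) //= coefZ coefXn eqxx mulr1.
rewrite big1 ?addr0 => [/eqP|i].
  by rewrite mulf_eq0 expf_eq0 (negPf P0) andbF orbF => /eqP.
rewrite -val_eqE /= coefZ coefXn => ij.
by rewrite (_ : (_ == _) = false) ?mulr0 //; have := ltn_ord i; lia.
Qed.

Lemma monomial_free_of_var (s : seq I) (d : I -> nat) : k \notin s ->
  free_of_var (\prod_(y <- s) 'x_y ^+ d y).
Proof.
move=> ks; rewrite /free_of_var !rmorph_prod; apply: eq_big_seq => y ys.
rewrite !rmorphXn poly_in_varX; case: eqVneq => // yk.
by rewrite -yk ys in ks.
Qed.

(** Setting every indeterminate to 1 gives 2, which is nonzero in the rationals. *)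
Lemma monomial_sum_neq0 (s t : seq I) (d : I -> nat) :
  \prod_(y <- s) 'x_y ^+ d y + \prod_(y <- t) 'x_y ^+ d y != 0.
Proof.
apply/eqP => /(congr1 (poly_eval (idfun : {rmorphism rat -> rat}) (fun=> 1))).
rewrite rmorph0 rmorphD !rmorph_prod !big1 // => y _;
  by rewrite rmorphXn poly_evalX expr1n.
Qed.

(** The zero diagonal entry keeps [x_k] out of both exchange monomials, as injectivity of the
    substitution requires. *)
Lemma mutation_endomorphism (D : exchange_data I) : bmat D k k = 0 ->
  exists E : {rmorphism ratfun I -> ratfun I},
    forall i, E (indet i) = var (mutate k (LabelledSeed (@indet I) D)) i.
Proof.
move=> bkk.
have monomialE (A : set I) : ~ A k -> exists2 s, k \notin s &
    \big[*%R/1]_(y \in A) indet y ^+ `|bmat D k y|%N =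
    frac (\prod_(y <- s) 'x_y ^+ `|bmat D k y|%N) :> ratfun I.
  (* The list [s] lies in [A]; it is empty by default if the support is infinite. *)
  move=> Ak; set s := finite_support _ _ _; exists s.
    rewrite /s; case: finite_supportP => // Y YA _ _.
    by apply/negP => kY; apply: Ak; apply: YA.
  by rewrite rmorph_prod; apply: eq_bigr => y _; rewrite rmorphXn.
pose L := LabelledSeed (@indet I) D.
have [P [P0 freeP PE]] : exists P,
    [/\ P != 0, free_of_var P & exchange_numerator L k = frac P].
  rewrite /exchange_numerator.
  have [|s ks ->] := monomialE [set y | 0 < bmat D k y]%classic.
    by rewrite /= bkk ltxx.
  have [|t kt ->] := monomialE [set y | bmat D k y < 0]%classic.
    by rewrite /= bkk ltxx.
  rewrite -rmorphD; eexists; split; last by [].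
    exact: monomial_sum_neq0.
  by rewrite /free_of_var !rmorphD !monomial_free_of_var.
have [E EE] := frac_lift (exchange_subst_inj P0 freeP).
exists E => i; rewrite {1}/indet EE poly_evalX /=.
by rewrite -/L PE; case: eqVneq => // ->.
Qed.

End ExchangeSubstitution.

(** * Transport of exchange numerators and mutation of matrices *)

(** A field morphism is injective, so a factor is 1 exactly when its image is: both products have
    the same support. *)
Lemma fsbig_rmorph (T : choiceType) (K L : fieldType) (phi : {rmorphism K -> L})
    (A : set T) (F : T -> K) :
  phi (\big[*%R/1]_(y \in A) F y) = \big[*%R/1]_(y \in A) phi (F y).
Proof.
have -> : finite_support 1 A (fun y => phi (F y)) = finite_support 1 A F.
  rewrite /finite_support !unlock; congr fset_set; apply/seteqP.
  split=> y [Ay Fy]; split=> // Fy1; apply: Fy.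
    by rewrite /= Fy1 rmorph1.
  by apply: (fmorph_inj phi); rewrite rmorph1.
exact: rmorph_prod.
Qed.

(** Applied with [h] the identity to compose mutations, and with [h] a cluster inclusion to mirror
    them. *)
Lemma exchange_numerator_transport (I J : countType) (h : I -> J)
    (phi : {rmorphism ratfun I -> ratfun J})
    (L : labelled_seed I) (L' : labelled_seed J) (k : I) : injective h ->
  (forall y, var L' (h y) = phi (var L y)) ->
  (forall y, bmat (data L') (h k) (h y) = bmat (data L) k y) ->
  (forall z, (forall y, z <> h y) -> bmat (data L') (h k) z = 0) ->
  exchange_numerator L' (h k) = phi (exchange_numerator L k).
Proof.
move=> h_inj varE bE b0; rewrite /exchange_numerator rmorphD !fsbig_rmorph.
have side (P : pred int) : P 0 = false ->
    \big[*%R/1]_(z \in [set z | P (bmat (data L') (h k) z)]%classic)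
      var L' z ^+ `|bmat (data L') (h k) z|%N =
    \big[*%R/1]_(y \in [set y | P (bmat (data L) k y)]%classic)
      (* [P] is one of the two sign conditions; it fails at 0, which discards the labels outside the
         image of [h]. *)
      phi (var L y ^+ `|bmat (data L) k y|%N).
  move=> P0.
  have -> : [set z | P (bmat (data L') (h k) z)]%classic =
            (h @` [set y | P (bmat (data L) k y)])%classic.
    apply/seteqP; split=> [z /= Pz|_ [y /= Py <-]]; last by rewrite /= bE.
    have [[y yz]|nz] := pselect (exists y, z = h y).
      by exists y => //; rewrite /= -bE -yz.
    by rewrite b0 ?P0 // in Pz => y yz; apply: nz; exists y.
  rewrite fsbig_image; last by move=> x y _ _ /h_inj.
  by apply: eq_fsbigr => y _; rewrite varE bE rmorphXn.
by congr (_ + _);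
  [apply: (side (fun b => 0 < b))|apply: (side (fun b => b < 0))]; rewrite ltxx.
Qed.

Lemma skew_symmetrisable_diag (I : countType) (b : I -> I -> int) (k : I) :
  skew_symmetrisable b -> b k k = 0.
Proof.
case=> d [d_gt0 skew]; have := skew k k; have := d_gt0 k.
move=> d0 /eqP; rewrite -addr_eq0 -mulr2n mulrn_eq0 /=.
by rewrite mulf_eq0 (gt_eqF d0) => /eqP.
Qed.

(** The division in [mutate_matrix] is exact: the sum is [2ac] or [-2ac] when the signs agree, and 0
    otherwise. *)
Lemma mutate_matrix_half (a c : int) :
  ((`|a| * c + a * `|c|) %/ 2)%Z * 2 = `|a| * c + a * `|c|.
Proof.
apply/divzK/dvdzP; case: (ger0P a) => _; case: (ger0P c) => _.
- by exists (a * c); ring.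
- by exists 0; ring.
- by exists 0; ring.
- by exists (- (a * c)); ring.
Qed.

Lemma mutate_matrix_skew (I : countType) (b : I -> I -> int) (k : I) :
  skew_symmetrisable b -> skew_symmetrisable (mutate_matrix b k).
Proof.
case=> d [d_gt0 skew]; exists d; split=> // y z; rewrite /mutate_matrix orbC.
case: ifP => _; first by rewrite !mulrN skew.
rewrite mulrDr skew [in RHS]mulrDr opprD; congr (_ + _).
have two : (2 : int) != 0 by [].
apply: (mulIf two); rewrite mulNr -!mulrA !mutate_matrix_half.
(* The same [d] works after mutation, since it also symmetrises the absolute values. *)
have norm_skew x : d x * `|b x k| = d k * `|b k x|.
  rewrite -{1}(gtr0_norm (d_gt0 x)) -{1}(gtr0_norm (d_gt0 k)).
  by rewrite -!normrM skew normrN.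
have := norm_skew y; have := norm_skew z; have := skew y k; have := skew z k.
move: (`|b y k|) (`|b k y|) (`|b z k|) (`|b k z|) => u v u' v' s1 s2 s3 s4.
transitivity ((d y * u) * b k z + (d y * b y k) * v'); first by ring.
transitivity (- ((d z * u') * b k y + (d z * b z k) * v)); last by ring.
by rewrite s1 s2 s3 s4; ring.
Qed.

(** * Algebraic freeness of clusters along mutations *)

Lemma indet_inj (I : countType) : injective (@indet I).
Proof.
move=> i j /eqP; rewrite tofrac_eq => /eqP eq_ij.
have evX := poly_evalX (idfun : {rmorphism rat -> rat}) (fun l => (l == i)%:R).
have := evX j; rewrite -eq_ij evX eqxx; by case: eqVneq.
Qed.

(* The existence of [E] says that the cluster of [L] is algebraically free. *)
Definition free_seed (I : countType) (L : labelled_seed I) : Prop :=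
  skew_symmetrisable (bmat (data L)) /\
  exists E : {rmorphism ratfun I -> ratfun I}, forall i, E (indet i) = var L i.

Lemma free_seed_initial (I : countType) (S : exchange_data I) :
  skew_symmetrisable (bmat S) -> free_seed (initial_seed S).
Proof. by split=> //; exists (idfun : {rmorphism _ -> _}). Qed.

(** First mutate the indeterminates by [M], then carry them to the cluster of [L] by [E], which
    commutes with exchange numerators. *)
Lemma free_seed_mutate (I : countType) (L : labelled_seed I) k :
  free_seed L -> free_seed (mutate k L).
Proof.
case=> skew [E EL]; split; first exact: mutate_matrix_skew.
have [M ML] := mutation_endomorphism (skew_symmetrisable_diag k skew).
exists (E \o M : {rmorphism _ -> _}) => i; rewrite /= ML /=.
case: eqVneq => [_|_]; last exact: EL.
rewrite fmorph_div EL; congr (_ / _); apply: esym.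
by apply: (@exchange_numerator_transport I I id) => //= z /(_ z).
Qed.

Lemma free_seed_var_inj (I : countType) (L : labelled_seed I) :
  free_seed L -> injective (var L).
Proof.
by case=> _ [E EL] i j; rewrite -!EL => /fmorph_inj /indet_inj.
Qed.

(** * Parallel mutation along an inclusion of clusters *)

Section ClusterInclusion.
Variables (I J : countType) (h : I -> J).
Hypothesis h_inj : injective h.

Lemma cluster_inclusion_field_morphism :
  exists2 phi : {rmorphism ratfun I -> ratfun J},
    forall i, phi (indet i) = indet (h i) &
    forall j, (forall i, j <> h i) -> forall z, phi z <> indet j.
Proof.
have [incl inclX] : exists f : {rmorphism polyring I -> polyring J},
    forall i, f 'x_i = 'x_(h i).
  by exists (poly_eval (@malgC _ rat) (fun i => 'x_(h i))); exact: poly_evalX.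
(* The retraction kills the indeterminates outside the image of [h]. It gives injectivity, and
   applied to [incl a = x_j * incl b] it forces [a = 0], so [phi] misses [x_j]. *)
pose retr_var (j : J) : polyring I :=
  if pselect (exists i, j = h i) is left ex then 'x_(projT1 (cid ex)) else 0.
have [retr retrX] : exists f : {rmorphism polyring J -> polyring I},
    forall j, f 'x_j = retr_var j.
  by exists (poly_eval (@malgC _ rat) retr_var); exact: poly_evalX.
have inclK : cancel incl retr.
  apply: (polyring_rmorph_ext (f := retr \o incl : {rmorphism _ -> _})
    (g := idfun)) => i /=.
  rewrite inclX retrX /retr_var; case: pselect => [ex|[]]; last by exists i.
  by case: cid => /= l /h_inj ->.
have e_inj : injective (frac \o incl : {rmorphism polyring I -> ratfun J}).
  by move=> p q /= /eqP; rewrite tofrac_eq => /eqP /(can_inj inclK).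
have [phi phiE] := frac_lift e_inj.
exists phi => [i|j jh z]; first by rewrite phiE /= inclX.
have [[a b] [/= b0 ->]] := fracP z; rewrite fmorph_div !phiE /=.
have incl_b0 : frac (incl b) != 0.
  by rewrite tofrac_eq0 -(rmorph0 incl) (can_eq inclK).
move=> eq_j; have /eqP : frac (incl a) = indet j * frac (incl b).
  by rewrite -eq_j divfK.
rewrite -[indet j * _]rmorphM tofrac_eq => /eqP eq_incl.
have a0 : a = 0.
  rewrite -(inclK a) eq_incl rmorphM retrX /retr_var.
  by case: pselect => [ex|_]; [have [i /jh] := ex|rewrite mul0r].
move: eq_incl; rewrite a0 rmorph0 => /esym/eqP.
rewrite mulf_eq0 -tofrac_eq0 -/(indet j) (negPf (indet_neq0 j)).
by rewrite -tofrac_eq0 (negPf incl_b0).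
Qed.

Variables (S : exchange_data I) (S' : exchange_data J).
Hypothesis h_ex : forall x, (h x \in ex S') = (x \in ex S).

(** Invariant of parallel mutation. Entries are required to vanish only against exchangeable labels,
    since frozen ones may be linked to labels outside the image. *)
Definition transported (phi : ratfun I -> ratfun J)
    (L : labelled_seed I) (L' : labelled_seed J) : Prop :=
  [/\ [/\ ex (data L) = ex S, ex (data L') = ex S',
      forall x, var L' (h x) = phi (var L x) &
      forall z, (forall x, z <> h x) -> var L' z = indet z],
      forall x y, bmat (data L') (h x) (h y) = bmat (data L) x y &
      forall x z, x \in ex S -> (forall y, z <> h y) ->
        bmat (data L') (h x) z = 0 /\ bmat (data L') z (h x) = 0].

Variable phi : {rmorphism ratfun I -> ratfun J}.

Lemma transported_mutate k L L' : k \in ex S ->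
  transported phi L L' -> transported phi (mutate k L) (mutate (h k) L').
Proof.
move=> k_ex [[exE exE' varE varN] bE b0].
have hkE x : (h k == h x) = (k == x) by exact: inj_eq.
have nhk z : (forall y, z <> h y) -> (h k == z) = false.
  by move=> nz; apply/eqP => /esym /nz.
split; first split => //=.
- move=> x; rewrite (inj_eq h_inj); case: eqVneq => [_|_]; last exact: varE.
  rewrite fmorph_div varE; congr (_ / _).
  apply: exchange_numerator_transport => // z nz.
  by have [] := b0 _ _ k_ex nz.
- by move=> z nz; rewrite eq_sym nhk // varN.
- by move=> x y; rewrite /= /mutate_matrix !hkE !bE.
(* Each product in the correction terms has a factor from the pair [h k], [z], which vanishes since
   [k] is exchangeable. *)
- move=> x z x_ex nz; have [xz zx] := b0 _ _ x_ex nz.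
  have [kz zk] := b0 _ _ k_ex nz.
  rewrite /= /mutate_matrix (nhk _ nz) orbF hkE /= xz zx kz zk.
  by case: ifP => _; rewrite ?oppr0 ?normr0 ?mulr0 ?mul0r ?addr0 ?div0z ?mulr0.
Qed.

Lemma transported_mutates s L L' M : transported phi L L' -> mutates L s M ->
  exists2 M', mutates L' (map phi s) M' & transported phi M M'.
Proof.
elim: s L L' => [|x s IHs] L L' tr /=; first by move=> ->; exists L'.
case=> k [k_ex <- sM]; case: (tr) => -[exE exE' varE _] _ _.
rewrite exE in k_ex; have tr' := transported_mutate k_ex tr.
have [M' sM' trM] := IHs _ _ tr' sM; exists M' => //.
by exists (h k); rewrite exE' h_ex varE.
Qed.

Hypothesis phi_transcendental :
  forall j, (forall i, j <> h i) -> forall z, phi z <> indet j.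

(* The labels mutated on both sides are determined by the variables: [var L] is
   injective, and the variables of [L'] outside of the image of [h] are
   indeterminates missed by [phi]. *)
Lemma transported_mutates_unique s L L' M M' :
  free_seed L -> transported phi L L' ->
  mutates L s M -> mutates L' (map phi s) M' -> transported phi M M'.
Proof.
elim: s L L' => [|x s IHs] L L' freeL tr /=; first by move=> -> ->.
case=> k [k_ex kx sM] [k' [_ k'x sM']].
case: (tr) => -[exE exE' varE varN] _ _.
rewrite exE in k_ex.
have k'E : k' = h k.
  have [[i k'i]|nk'] := pselect (exists i, k' = h i).
    rewrite k'i; congr h; apply: (free_seed_var_inj freeL).
    by apply: (fmorph_inj phi); rewrite -varE -k'i k'x kx.
  have k'_out i : k' <> h i by move=> k'i; apply: nk'; exists i.
  by have := phi_transcendental k'_out (z := x); rewrite -k'x varN.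
rewrite k'E in sM'.
exact: IHs (free_seed_mutate k freeL) (transported_mutate k_ex tr) sM sM'.
Qed.

End ClusterInclusion.

Lemma cluster_inclusion_induces (I J : countType) (h : I -> J)
    (S : exchange_data I) (S' : exchange_data J) :
  injective h -> skew_symmetrisable (bmat S) ->
  (forall x, (h x \in ex S') = (x \in ex S)) ->
  (forall x y, bmat S' (h x) (h y) = bmat S x y) ->
  (forall x z, x \in ex S -> (forall y, z <> h y) ->
    bmat S' (h x) z = 0 /\ bmat S' z (h x) = 0) ->
  induces_injective_rooted_cluster_morphism S S' h.
Proof.
move=> h_inj skew h_ex hB hB0.
have [phi phiE phi_out] := cluster_inclusion_field_morphism h_inj.
exists phi; split=> //.
have tr0 : transported h S S' phi (initial_seed S) (initial_seed S').
  by split=> //; split=> //= x; rewrite phiE.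
have phi_sub a : a \in cluster_subring S -> phi a \in cluster_subring S'.
  (* The preimage of the target algebra is a subring; mirrored mutations show that it contains every
     cluster variable of [S]. *)
  pose Q : {pred ratfun I} := fun x => phi x \in cluster_subring S'.
  have inQ x : phi x \in cluster_subring S' -> x \in Q.
    by move=> px; rewrite unfold_in.
  have [c1 cB cM] := cluster_subringP S'.
  move=> /asboolP /(_ Q); apply.
    split=> [|x y px py|x y px py]; apply: inQ.
    - by rewrite rmorph1.
    - by rewrite rmorphB; apply: cB.
    - by rewrite rmorphM; apply: cM.
  move=> L i [s sL]; have [L' sL' [[_ _ varE _] _ _]] :=
    transported_mutates h_inj h_ex tr0 sL.
  apply: inQ; rewrite -varE.
  by apply: var_in_cluster_subring; exists (map phi s).
pose f (a : cluster_algebra S) : cluster_algebra S' :=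
  ClusterAlgebra (phi_sub _ (cvalP a)).
have fB : zmod_morphism f by move=> a b; apply: val_inj; rewrite /= rmorphB.
have fM : monoid_morphism f.
  by split=> [|a b]; apply: val_inj; rewrite /= ?rmorph1 ?rmorphM.
pose f1 := GRing.isZmodMorphism.Build _ _ f fB.
pose f2 := GRing.isMonoidMorphism.Build _ _ f fM.
pose F : {rmorphism cluster_algebra S -> cluster_algebra S'} :=
  HB.pack f f1 f2.
have fX x : F (initial_var S x) = initial_var S' (h x).
  by apply: val_inj; rewrite /= phiE.
exists F; split=> //.
  by move=> a b /(congr1 (@cval _ _)) /= /fmorph_inj /val_inj.
split=> [x|x x_ex|s L L' sL sL' y].
- by left; exists (h x).
- by left; exists (h x); rewrite ?h_ex.
right; exists (h y) => //=.
rewrite (_ : map _ s = map phi (map (@cval _ S) s)) in sL'.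
  have [[_ _ varE _] _ _] := transported_mutates_unique h_inj phi_out
    (free_seed_initial skew) tr0 sL sL'.
  by rewrite varE.
by rewrite -map_comp.
Qed.

(** * The two inclusions into the amalgamated sum *)

Section Amalgam.
Variables (I1 I2 : countType) (S1 : exchange_data I1) (S2 : exchange_data I2).
Variables (D1 : {pred I1}) (D2 : {pred I2}) (g : glueing S1 S2 D1 D2).
Local Notation amalg := (amalgamated_sum g).
Local Notation incl1 := (@amalg_incl1 I1 I2 D1 D2).
Local Notation incl2 := (amalg_incl2 g).

Definition amalg_proj1 (z : amalg_index D1 D2) : option I1 :=
  match z with
  | inl (inl u) => Some (val u)
  | inl (inr _) => None
  | inr u => Some (val u)
  end.

Definition amalg_proj2 (z : amalg_index D1 D2) : option I2 :=
  match z with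
  | inl (inl _) => None
  | inl (inr u) => Some (val u)
  | inr u => Some (glue g u)
  end.

(* [case: boolP] on the body of [amalg_incl1] would also abstract the membership
   test in the types of the subset elements. *)
Variant amalg_incl1_spec x : amalg_index D1 D2 -> Type :=
  | AmalgIncl1Glued (hx : x \in D1) : amalg_incl1_spec x (inr (exist _ x hx))
  | AmalgIncl1Free (hx : x \notin D1) :
      amalg_incl1_spec x (inl (inl (exist _ x hx))).

Lemma amalg_incl1P x : amalg_incl1_spec x (incl1 x).
Proof. by rewrite /amalg_incl1; destruct (boolP (x \in D1)); constructor. Qed.

Variant amalg_incl2_spec x : amalg_index D1 D2 -> Type :=
  | AmalgIncl2Glued (hx : x \in D2) :
      amalg_incl2_spec x (inr (iso_inv (glue_iso g) (exist _ x hx)))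
  | AmalgIncl2Free (hx : x \notin D2) :
      amalg_incl2_spec x (inl (inr (exist _ x hx))).

Lemma amalg_incl2P x : amalg_incl2_spec x (incl2 x).
Proof. by rewrite /amalg_incl2; destruct (boolP (x \in D2)); constructor. Qed.

Lemma amalg_incl1K : pcancel incl1 amalg_proj1.
Proof. by move=> x; case: amalg_incl1P. Qed.

Lemma amalg_incl2K : pcancel incl2 amalg_proj2.
Proof.
by move=> x; case: amalg_incl2P => //= hx; rewrite /glue iso_invK.
Qed.

Lemma amalg_proj1K z x : amalg_proj1 z = Some x -> z = incl1 x.
Proof.
case: z => [[u|u]|u] //= [<-]; case: amalg_incl1P => hu.
- by have := valP u; rewrite hu.
- by congr (inl (inl _)); apply: val_inj.
- by congr inr; apply: val_inj.
- by have := valP u; rewrite (negPf hu).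
Qed.

Lemma amalg_proj2K z x : amalg_proj2 z = Some x -> z = incl2 x.
Proof.
case: z => [[u|u]|u] //= [<-]; case: amalg_incl2P => hu.
- by have := valP u; rewrite hu.
- by congr (inl (inr _)); apply: val_inj.
- congr inr; apply: (can_inj (iso_funK (glue_iso g))).
  by apply: val_inj; rewrite iso_invK.
- by have := valP (iso_fun (glue_iso g) u); rewrite (negPf hu).
Qed.

Lemma amalg_incl1_ex x : (incl1 x \in ex amalg) = (x \in ex S1).
Proof. by case: amalg_incl1P => // hx; rewrite (negPf (frozen1 g hx)). Qed.

Lemma amalg_incl2_ex x : (incl2 x \in ex amalg) = (x \in ex S2).
Proof. by case: amalg_incl2P => // hx; rewrite (negPf (frozen2 g hx)). Qed.

Lemma amalg_incl1_bmat x y : bmat amalg (incl1 x) (incl1 y) = bmat S1 x y.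
Proof. by case: amalg_incl1P => ?; case: amalg_incl1P. Qed.

Lemma amalg_incl2_bmat x y : bmat amalg (incl2 x) (incl2 y) = bmat S2 x y.
Proof.
case: amalg_incl2P => hx; case: amalg_incl2P => hy /=;
  rewrite /glue ?iso_invK //.
have /= <- := iso_bmat (glue_iso g) (iso_inv (glue_iso g) (exist _ x hx))
  (iso_inv (glue_iso g) (exist _ y hy)).
by rewrite !iso_invK.
Qed.

(** An exchangeable label is not glued, and a label outside the image is an unglued label of [S2];
    the two blocks joining these are zero. *)
Lemma amalg_incl1_bmat0 x z : x \in ex S1 -> (forall y, z <> incl1 y) ->
  bmat amalg (incl1 x) z = 0 /\ bmat amalg z (incl1 x) = 0.
Proof.
move=> x_ex; case zE : (amalg_proj1 z) => [y|] nz.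
  by case: (nz y); apply: amalg_proj1K.
case: amalg_incl1P => hx; first by rewrite (negPf (frozen1 g hx)) in x_ex.
by case: z zE {nz} => [[]|].
Qed.

Lemma amalg_incl2_bmat0 x z : x \in ex S2 -> (forall y, z <> incl2 y) ->
  bmat amalg (incl2 x) z = 0 /\ bmat amalg z (incl2 x) = 0.
Proof.
move=> x_ex; case zE : (amalg_proj2 z) => [y|] nz.
  by case: (nz y); apply: amalg_proj2K.
case: amalg_incl2P => hx; first by rewrite (negPf (frozen2 g hx)) in x_ex.
by case: z zE {nz} => [[]|].
Qed.

End Amalgam.

Theorem lemma4p13 (I1 I2 : countType)
    (S1 : exchange_data I1) (S2 : exchange_data I2)
    (D1 : {pred I1}) (D2 : {pred I2})
    (hS1 : is_seed S1) (hS2 : is_seed S2)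
    (g : glueing S1 S2 D1 D2) :
  induces_injective_rooted_cluster_morphism S1 (amalgamated_sum g)
    (@amalg_incl1 I1 I2 D1 D2) /\
  induces_injective_rooted_cluster_morphism S2 (amalgamated_sum g)
    (amalg_incl2 g).
Proof.
split; apply: cluster_inclusion_induces.
- exact: pcan_inj (@amalg_incl1K _ _ _ _).
- exact: hS1.2.
- exact: amalg_incl1_ex.
- exact: amalg_incl1_bmat.
- exact: amalg_incl1_bmat0.
- exact: pcan_inj (amalg_incl2K g).
- exact: hS2.2.
- exact: amalg_incl2_ex.
- exact: amalg_incl2_bmat.
- exact: amalg_incl2_bmat0.
Qed.
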